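(* Let $n\ge2$ be an integer and let $I$ be a set of $3n$ consecutive positive integers, all greater than $2n+2$. Then $|I\cap U(1,n)|\le n+1$.
   Context: For an integer $n\ge2$, $U(1,n)$ is the Ulam sequence: the increasing sequence with first terms $1,n$, each subsequent term being the smallest integer larger than the previous term that is a sum $u+v$ of two earlier terms $u<v$ in exactly one way; it is identified with its set of terms. *)

(* Defs.v *)
From mathcomp Require Import all_boot.
From mathcomp Require Import boolp classical_sets cardinality.

Set Implicit Arguments.
Unset Strict Implicit.
Unset Printing Implicit Defensive.

Local Open Scope classical_set_scope.

Definition sum_exactly_one_way (s : seq nat) (m : nat) : Prop :=
  exists! p : nat * nat,
    [/\ p.1 \in s, p.2 \in s, p.1 < p.2 & p.1 + p.2 = m].

(* [mkseq u k.+2] lists the terms preceding [u k.+2]. *)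
Definition is_ulam_seq (a b : nat) (u : nat -> nat) : Prop :=
  [/\ u 0 = a, u 1 = b &
    forall k, [/\ u k.+1 < u k.+2,
                  sum_exactly_one_way (mkseq u k.+2) (u k.+2) &
                  forall m, u k.+1 < m ->
                    sum_exactly_one_way (mkseq u k.+2) m -> u k.+2 <= m]].

Definition consecutive (c : nat) (I : set nat) : Prop :=
  exists a, I = [set x | a <= x < a + c].

(* Well-posedness: for 0 < a < b the Ulam sequence with first terms a, b exists and
   is unique. *)

Lemma is_ulam_seq_unique a b u v :
  is_ulam_seq a b u -> is_ulam_seq a b v -> u =1 v.
Proof.
move=> [u0 u1 uS] [v0 v1 vS].
suff H k i : i < k.+2 -> u i = v i by move=> i; apply: (H i).
elim: k i => [|k IHk] i.
  by case: i => [|[|]] // _; rewrite ?u0 ?v0 ?u1 ?v1.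
rewrite ltnS leq_eqVlt => /orP[/eqP->|]; last exact: IHk.
have E : mkseq u k.+2 = mkseq v k.+2.
  by apply/eq_in_map => j; rewrite mem_iota => /andP[_ /IHk].
have [u_lt us um] := uS k; have [v_lt vs vm] := vS k.
have e1 : u k.+1 = v k.+1 by exact: IHk.
by apply/eqP; rewrite eqn_leq um ?vm -?E // ?E -?e1 // e1.
Qed.

Lemma sum_last_two (s : seq nat) x y : x < y -> (forall z, z \in s -> z < x) ->
  sum_exactly_one_way (rcons (rcons s x) y) (x + y).
Proof.
move=> xy sx; exists (x, y); split=> [|[p q]] /=.
  by split=> //; rewrite !(mem_rcons, inE) eqxx ?orbT.
rewrite !(mem_rcons, inE) => -[pI qI pq pqE].
have le_y z : [|| z == y, z == x | z \in s] -> z <= y.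
  by case/or3P=> [/eqP->//|/eqP->|/sx zx]; rewrite ltnW ?(ltn_trans zx).
have py : p < y by apply: leq_trans pq (le_y _ qI).
case/or3P: pI => [/eqP pE|/eqP pE|/sx px]; first by rewrite pE ltnn in py.
  by move/eqP: pqE; rewrite pE eqn_add2l => /eqP ->.
by move: (leq_add px (le_y _ qI)); rewrite addSn pqE ltnn.
Qed.

Lemma ulam_next (s : seq nat) x y : 0 < x < y -> (forall z, z \in s -> z < x) ->
  exists m, [/\ y < m, sum_exactly_one_way (rcons (rcons s x) y) m &
    forall m', y < m' -> sum_exactly_one_way (rcons (rcons s x) y) m' ->
      m <= m'].
Proof.
case/andP=> x_gt0 xy sx.
pose P m := (y < m) && `[< sum_exactly_one_way (rcons (rcons s x) y) m >].
have exP : exists m, P m.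
  exists (x + y); rewrite /P -[X in X < _]add0n ltn_add2r x_gt0.
  exact/asboolP/sum_last_two.
case: (ex_minnP exP) => m /andP[ym /asboolP sm] min_m; exists m; split=> //.
by move=> m' ym' sm'; apply: min_m; rewrite /P ym'; apply/asboolP.
Qed.

Lemma is_ulam_seq_exists a b : 0 < a < b -> exists u, is_ulam_seq a b u.
Proof.
move=> ab.
pose good (s : seq nat) (x y : nat) := 0 < x < y /\ forall z, z \in s -> z < x.
pose next s x y m := [/\ y < m, sum_exactly_one_way (rcons (rcons s x) y) m &
  forall m', y < m' -> sum_exactly_one_way (rcons (rcons s x) y) m' -> m <= m'].
have [f fP] : {f : seq nat * nat * nat -> nat &
    forall t, good t.1.1 t.1.2 t.2 -> next t.1.1 t.1.2 t.2 (f t)}.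
  apply: (@boolp.choice _ _ (fun t m => good t.1.1 t.1.2 t.2 ->
    next t.1.1 t.1.2 t.2 m)) => -[[s x] y] /=.
  have [[xy sx]|ng] := pselect (good s x y); last by exists 0.
  by have [m mP] := ulam_next xy sx; exists m.
pose step t := (rcons t.1.1 t.1.2, t.2, f t).
pose st k := iter k step ([::], a, b).
pose u k := (st k).1.2.
have uS k : u k.+1 = (st k).2 by [].
have st1 k : (st k).1.1 = mkseq u k.
  by elim: k => //= k IHk; rewrite mkseqS -IHk.
have good_st k : good (st k).1.1 (st k).1.2 (st k).2.
  elim: k => [|k IHk]; first by split.
  have [ylt _ _] := fP _ IHk; case: IHk => /andP[x0 xy] sx.
  split=> /=; first by rewrite ylt (ltn_trans x0 xy).
  move=> z; rewrite mem_rcons inE => /orP[/eqP->//|/sx zx].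
  exact: ltn_trans zx xy.
exists u; split=> // k.
have := fP _ (good_st k); rewrite /next st1 -uS -/(u k) -!mkseqS.
by rewrite -[f _]/(u k.+2).
Qed.

(* Main.v *)
(** Since 1 and n, ..., 2n are terms, a term m > 2n has at most one of
    m - 1 and m - 2n, ..., m - n among the terms above 2n. Let m be the largest
    term in I and m' the smallest term in I above m - n. The windows
    [m - 2n, m - n] and [m' - 2n, m' - n] cover all integers from m' - 2n to
    m - n and contain at most one term of I each. Adding the integers of
    [m', m] and those of I below m' - 2n bounds the number of terms by n + 2.
    One unit is gained in every case: if m' = m the windows coincide; if
    m' < m and m - 1 is a term the first window is empty; otherwise m - 1 in
    [m', m] is not a term. *)
Require Import Defs.
From mathcomp Require Import all_boot zify.
From mathcomp Require Import boolp classical_sets cardinality.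

Local Open Scope classical_set_scope.
Local Open Scope card_scope.

Section Count.
Variable Q : pred nat.

Definition count_in (x y : nat) := \sum_(x <= i < y) Q i.

Lemma count_in_le x y : count_in x y <= y - x.
Proof.
by rewrite -[y - x]muln1 -sum_nat_const_nat; apply: leq_sum => i _; case: (Q i).
Qed.

Lemma count_in_cat x y z : x <= y <= z -> count_in x z = count_in x y + count_in y z.
Proof. by case/andP=> xy yz; rewrite /count_in (big_cat_nat xy yz). Qed.

Lemma count_in_eq0 x y : (forall i, x <= i < y -> ~~ Q i) -> count_in x y = 0.
Proof.
by move=> nQ; apply: big1_seq => i /=; rewrite mem_index_iota => /nQ/negbTE ->.
Qed.

Lemma count_in_sub x y x' y' :
  x' <= x -> y <= y' -> count_in x y <= count_in x' y'.
Proof.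
move=> xx yy; have [xy|yx] := leqP x y.
  by rewrite (@count_in_cat x' x y') ?(@count_in_cat x y y'); lia.
by have := count_in_le x y; lia.
Qed.

Lemma count_in_le1 x y :
  (forall i j, x <= i -> i < j -> j < y -> Q i -> Q j -> False) ->
  count_in x y <= 1.
Proof.
move=> uQ; case: (pselect (exists i, (x <= i < y) && Q i)) => [[i /andP[xiy Qi]]|nQ].
  rewrite (@count_in_cat x i y) ?(@count_in_cat i i.+1 y); try lia.
  rewrite (@count_in_eq0 x i) ?(@count_in_eq0 i.+1 y); last 1 first.
  - by move=> j Hj; apply/negP => Qj; apply: (uQ j i) => //; lia.
  - by have := count_in_le i i.+1; lia.
  by move=> j Hj; apply/negP => Qj; apply: (uQ i j) => //; lia.
rewrite count_in_eq0 // => i Hi; apply/negP => Qi; apply: nQ.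
by exists i; rewrite Hi.
Qed.

End Count.

(** The counting argument, detached from Ulam sequences: all it keeps of unique representability is
    that [m = (m - x) + x = (m - y) + y] cannot hold in two ways with both [m - x] and [m - y] among
    the known small terms. *)
Lemma count_in_sparse (n a : nat) (Q : pred nat) :
  1 < n -> 2 * n < a -> (forall x, Q x -> a <= x < a + 3 * n) ->
  (forall m x y, Q m -> Q x -> Q y -> x < y -> n <= m - x <= 2 * n ->
     (m - y == 1) || (n <= m - y <= 2 * n) -> False) ->
  count_in Q 0 (a + 3 * n) <= n + 1.
Proof.
move=> n2 an Qb Q1.
case: (pselect (exists i, Q i)) => [exQ|nQ]; last first.
  rewrite count_in_eq0 // => i _; apply/negP => Qi.
  by apply: nQ; exists i.
have ubQ i : Q i -> i <= a + 3 * n by move/Qb; lia.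
case: (ex_maxnP exQ ubQ) => m Qm mmax.
(* With [m' > m - n], the window of [m'] ends no lower than [m - 2 * n], so the two windows leave no
   gap. *)
have ex' : exists i, Q i && (m < i + n) by exists m; rewrite Qm; lia.
case: (ex_minnP ex') => m' /andP[Qm' mm'] m'min.
have mb := Qb _ Qm; have m'b := Qb _ Qm'; have m'm := mmax _ Qm'.
have window k : Q k -> count_in Q (k - 2 * n) (k - n).+1 <= 1.
  move=> Qk; have kb := Qb _ Qk.
  by apply: count_in_le1 => i j ki ij jk Qi Qj; apply: (Q1 k i j) => //; lia.
(* The range is cut at [m' - 2 * n], [m' - n + 1], [m - n + 1], [m'] and [m + 1]. The top piece is
   empty by maximality of [m], the one from [m - n + 1] to [m'] by minimality of [m']. *)
rewrite (@count_in_cat _ 0 m.+1); last lia.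
rewrite [X in _ + X]count_in_eq0; last first.
  by move=> i Hi; apply/negP => /mmax; lia.
rewrite (@count_in_cat _ 0 m'); last lia.
rewrite (@count_in_cat _ 0 (m - n).+1); last lia.
rewrite [count_in _ (m - n).+1 m']count_in_eq0; last first.
  by move=> i Hi; apply/negP => Qi; have := m'min i; rewrite Qi; lia.
rewrite (@count_in_cat _ 0 (m' - n).+1); last lia.
rewrite (@count_in_cat _ 0 (m' - 2 * n)); last lia.
(* Truncated subtraction makes this bound 0 when [m' - 2 * n] is below [a]. *)
have low : count_in Q 0 (m' - 2 * n) <= m' - 2 * n - a.
  have [am|ma] := leqP a (m' - 2 * n).
    rewrite (@count_in_cat _ 0 a); last lia.
    rewrite [X in X + _]count_in_eq0 ?count_in_le // => i Hi.
    by apply/negP => /Qb; lia.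
  by rewrite count_in_eq0 // => i Hi; apply/negP => /Qb; lia.
have w' := window _ Qm'.
have mid : count_in Q (m' - n).+1 (m - n).+1 <= count_in Q (m - 2 * n) (m - n).+1.
  by apply: count_in_sub; lia.
have w := window _ Qm.
have top := count_in_le Q m' m.+1.
(* The bounds so far add up to at most [n + 2]: if [a <= m' - 2 * n] because [m < a + 3 * n],
   otherwise because [m < m' + n]. *)
have [eqm|nem] := eqVneq m' m.
  have := count_in_le Q (m' - n).+1 (m - n).+1; lia.
have [Qm1|nQm1] := boolP (Q m.-1).
  (* The window lies strictly below [m - 1] because [n >= 2], so any term in it would compete with
     [m = 1 + (m - 1)]. *)
  have w0 : count_in Q (m - 2 * n) (m - n).+1 = 0.
    apply: count_in_eq0 => i Hi; apply/negP => Qi.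
    by apply: (Q1 m i m.-1) => //; lia.
  by lia.
have top' : count_in Q m' m.+1 <= m - m'.
  rewrite (@count_in_cat _ m' m.-1); last lia.
  rewrite (@count_in_cat _ m.-1 m); last lia.
  rewrite [X in _ + (X + _)]count_in_eq0; last first.
    by move=> i Hi; have -> : i = m.-1 by lia.
  by have := count_in_le Q m' m.-1; have := count_in_le Q m m.+1; lia.
by lia.
Qed.

(** Up to [2 * n] each integer above [n] is 1 plus its predecessor, and in no other way: two
    distinct terms that are at least [n] sum to more than [2 * n]. *)
Lemma ulam_1n_initial n u j :
  2 <= n -> is_ulam_seq 1 n u -> j <= n -> u j.+1 = n + j.
Proof.
move=> n2 [u0 u1 uS].
elim/ltn_ind: j => -[|j] IH jn; first by rewrite u1 addn0.
have val i : i < j.+2 -> u i = if i is i'.+1 then n + i' else 1.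
  by case: i => [|i] // ij; apply: IH; lia.
have [ult _ umin] := uS j.
apply/eqP; rewrite eqn_leq; apply/andP; split; last by rewrite val in ult; lia.
apply: umin; first by rewrite val; lia.
exists (1, n + j); split=> [|[p q]] /=.
  split; try lia.
    by apply/mapP; exists 0; rewrite ?mem_iota ?u0.
  by apply/mapP; exists j.+1; rewrite ?mem_iota ?val //; lia.
case=> /mapP[i]; rewrite mem_iota => /andP[_ ij] ->.
move=> /mapP[i']; rewrite mem_iota => /andP[_ i'j] ->.
rewrite !val //; case: i ij => [|i] ij; case: i' i'j => [|i'] i'j; try lia.
by move=> _ E; congr pair; lia.
Qed.

Lemma ulam_homo a b u : a < b -> is_ulam_seq a b u -> {homo u : i j / i < j}.
Proof.
move=> ab [u0 u1 uS]; apply: homo_ltn; first exact: ltn_trans.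
by case=> [|k]; [rewrite u0 u1|have [] := uS k].
Qed.

Lemma ulam_sum_unique a b u x y x' y' : 0 < a < b -> is_ulam_seq a b u ->
  range u x -> range u y -> range u x' -> range u y' -> range u (x + y) ->
  b < x + y -> x < y -> x' < y' -> x + y = x' + y' -> x = x'.
Proof.
move=> /andP[a0 ab] hu Ux Uy Ux' Uy' [k _ kE] bxy xy xy' E.
have homo := ulam_homo _ _ _ ab hu; have mono := leqW_mono (leq_mono homo).
case: hu => u0 u1 uS.
have pos z : range u z -> 0 < z.
  move=> [[|i] _ <-]; first by rewrite u0.
  by have := homo 0 i.+1 isT; lia.
(* As [x + y] exceeds [b], it is not one of the two initial terms, so the uniqueness clause applies
   to it. *)
case: k kE => [|[|k]] kE; try lia.
have [_ [p [_ pu]] _] := uS k.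
(* Terms are positive, so each summand is below the sum and hence occurs earlier in the sequence. *)
have mem z : range u z -> z < x + y -> z \in mkseq u k.+2.
  move=> [i _ <-]; rewrite -kE mono => ik.
  by apply/mapP; exists i; rewrite ?mem_iota.
have := pos _ Ux; have := pos _ Ux'; have := pos _ Uy; have := pos _ Uy' => ????.
have e1 : p = (x, y) by apply: pu; split=> //; apply: mem => //=; lia.
have e2 : p = (x', y').
  by apply: pu; split=> //=; [apply: mem => //; lia..|lia].
by move: e2; rewrite e1 => -[].
Qed.

(** The rank [f x], the number of elements of [A] below [x], embeds [A] into the integers below
    [k]. *)
Lemma card_le_count_in (A : set nat) (N k : nat) :
  (forall x, A x -> x < N) -> count_in (fun x => `[< A x >]) 0 N <= k ->
  A #<= `I_k.
Proof.
set Q := fun x => _; move=> AN Nk; pose f := count_in Q 0.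
have fS x : A x -> f x.+1 = (f x).+1.
  move=> Ax; rewrite /f (@count_in_cat _ 0 x) ?leqnSn //.
  by rewrite {2}/count_in big_nat1 /Q asboolT // addn1.
have f_lt x y : A x -> x < y -> f x < f y.
  by move=> Ax xy; rewrite -(fS _ Ax); apply: count_in_sub.
have f_inj : {in A &, injective f}.
  move=> x y /set_mem Ax /set_mem Ay fxy.
  have [xy|yx|//] := ltngtP x y.
    by have := f_lt _ _ Ax xy; rewrite fxy ltnn.
  by have := f_lt _ _ Ay yx; rewrite fxy ltnn.
rewrite -(card_le_eql (inj_card_eq f_inj)); apply: subset_card_le.
by move=> _ [x Ax <-] /=; apply: leq_trans Nk; apply: f_lt (AN _ Ax).
Qed.

Theorem theorem4p4 (n : nat) (n_ge2 : 2 <= n)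
    (u : nat -> nat) (hu : is_ulam_seq 1 n u)
    (I : set nat) (hI : consecutive (3 * n) I)
    (I_gt : forall x, I x -> 2 * n + 2 < x) :
  I `&` range u #<= `I_(n + 1).
Proof.
case: hI => a IE.
have an : 2 * n + 2 < a by apply: I_gt; rewrite IE /=; lia.
have Ib x : (I `&` range u) x -> a <= x < a + 3 * n by rewrite IE => -[].
apply: (@card_le_count_in _ (a + 3 * n)) => [x /Ib/andP[] //|].
apply: count_in_sparse => [//||x /asboolP/Ib //|m x y]; first lia.
move=> /asboolP Am /asboolP Ax /asboolP Ay xy xE yE.
have mb := Ib _ Am; have xb := Ib _ Ax; have yb := Ib _ Ay.
case: Am Ax Ay => [_ Um] [_ Ux] [_ Uy].
have Us k : (k == 1) || (n <= k <= 2 * n) -> range u k.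
  case/orP=> [/eqP->|kn]; first by exists 0 => //; case: hu.
  exists (k - n).+1 => //; rewrite (ulam_1n_initial n) //; lia.
have mx : m - x + x = m by lia.
(* Both [m - x] and [m - y] are at most [2 * n], hence smaller than [x] and [y], so each pair of
   summands is correctly ordered. *)
suff : m - x = m - y by lia.
apply: (ulam_sum_unique 1 n u (m - x) x (m - y) y) => //; try lia.
- by apply: Us; lia.
- exact: Us.
- by rewrite mx.
Qed.
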